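(* Each of the following graph classes has maximum cop number equal to $+\infty$: the class of line graphs; the class of 2-interval graphs; the class of 2-unit-interval graphs; the class of intersection graphs of axis-parallel segments in $\mathbb{R}^3$; the class of intersection graphs of axis-parallel boxes in $\mathbb{R}^3$ (boxicity at most 3); the class of intersection graphs of unit cubes in $\mathbb{R}^3$; the class of intersection graphs of balls in $\mathbb{R}^3$; and the class of intersection graphs of unit balls in $\mathbb{R}^3$.
   Context: Game of cops and robber on a finite graph $G$: first $k$ cops are placed on vertices, then the robber; players then alternate starting with the cops; in a move each cop (resp. the robber) stays or moves to an adjacent vertex. The robber is captured when a cop occupies his vertex. $\textrm{cn}(G)$ is the least $k$ such that $k$ cops can force capture. For a class $\mathcal C$, $\textrm{max-cn}(\mathcal C)$ is the supremum of $\textrm{cn}(G)$ over connected $G\in\mathcal C$. A line graph is the intersection graph of the edges of some graph (two edges adjacent iff they share an endpoint). A 2-interval graph is an intersection graph of sets each of which is a union of 2 closed intervals of $\mathbb{R}$; a 2-unit-interval graph is such a graph where all these intervals have length one. Intersection graph of a family of sets: vertices are the sets, two distinct vertices adjacent iff their sets intersect. *)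

(* Defs.v *)
From mathcomp Require Import all_boot.
From Stdlib Require Import Reals.

Set Implicit Arguments.
Unset Strict Implicit.
Unset Printing Implicit Defensive.

Definition simple_graph (T : finType) (e : rel T) : Prop :=
  symmetric e /\ irreflexive e.

Definition connected_graph (T : finType) (e : rel T) : Prop :=
  0 < #|T| /\ forall x y : T, connect e x y.

Definition step (T : finType) (e : rel T) (u v : T) : Prop := u = v \/ e u v.

(* cop_win e k c r : the k cops, at positions c, are to move, the robber is
   at r (not yet captured); the cops can force capture in finitely many
   rounds.  Capture happens when, after the cops' move, some cop occupies the
   robber's vertex, or when the robber moves onto a vertex occupied by a cop. *)
Inductive cop_win (T : finType) (e : rel T) (k : nat) : ('I_k -> T) -> T -> Prop :=
| cop_win_step (c : 'I_k -> T) (r : T) (c' : 'I_k -> T) :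
    (forall i, step e (c i) (c' i)) ->
    ((exists i, c' i = r) \/
     (forall r', step e r r' -> (exists i, c' i = r') \/ cop_win e c' r')) ->
    cop_win e c r.

Definition cops_win (T : finType) (e : rel T) (k : nat) : Prop :=
  exists c0 : 'I_k -> T, forall r0 : T, (exists i, c0 i = r0) \/ cop_win e c0 r0.

Definition graph_class := forall T : finType, rel T -> Prop.

Definition max_cn_infinite (C : graph_class) : Prop :=
  forall k : nat, exists (T : finType) (e : rel T),
    simple_graph e /\ connected_graph e /\ C T e /\ ~ cops_win e k.

(* G is the line graph of some finite simple graph H on vertex set U:
   vertices of G correspond bijectively to the edges of H (2-element subsets
   of U), adjacent iff the edges share an endpoint. *)
Definition line_graph_class : graph_class := fun T e =>
  exists (U : finType) (ends : T -> {set U}),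
    (forall x, #|ends x| = 2) /\ injective ends /\
    (forall x y, x <> y -> (e x y <-> ends x :&: ends y != set0)).

Definition intersection_class (P : Type) (C : (P -> Prop) -> Prop) : graph_class :=
  fun T e => exists S : T -> P -> Prop,
    (forall x, C (S x)) /\
    (forall x y, x <> y -> (e x y <-> exists p, S x p /\ S y p)).

Local Open Scope R_scope.

Definition closed_interval (a b t : R) : Prop := a <= t <= b.

Definition two_interval (S : R -> Prop) : Prop :=
  exists a1 b1 a2 b2 : R, a1 <= b1 /\ a2 <= b2 /\
    forall t, S t <-> closed_interval a1 b1 t \/ closed_interval a2 b2 t.

Definition two_unit_interval (S : R -> Prop) : Prop :=
  exists a1 a2 : R,
    forall t, S t <-> closed_interval a1 (a1 + 1) t \/ closed_interval a2 (a2 + 1) t.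

Definition pt3 := (R * R * R)%type.
Definition px (p : pt3) : R := p.1.1.
Definition py (p : pt3) : R := p.1.2.
Definition pz (p : pt3) : R := p.2.

Definition in_box (a1 b1 a2 b2 a3 b3 : R) (p : pt3) : Prop :=
  closed_interval a1 b1 (px p) /\ closed_interval a2 b2 (py p) /\
  closed_interval a3 b3 (pz p).

Definition box3 (S : pt3 -> Prop) : Prop :=
  exists a1 b1 a2 b2 a3 b3 : R, a1 <= b1 /\ a2 <= b2 /\ a3 <= b3 /\
    forall p, S p <-> in_box a1 b1 a2 b2 a3 b3 p.

Definition axis_segment3 (S : pt3 -> Prop) : Prop :=
  exists a1 b1 a2 b2 a3 b3 : R, a1 <= b1 /\ a2 <= b2 /\ a3 <= b3 /\
    ((a1 = b1 /\ a2 = b2) \/ (a1 = b1 /\ a3 = b3) \/ (a2 = b2 /\ a3 = b3)) /\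
    forall p, S p <-> in_box a1 b1 a2 b2 a3 b3 p.

Definition unit_cube3 (S : pt3 -> Prop) : Prop :=
  exists a1 a2 a3 : R,
    forall p, S p <-> in_box a1 (a1 + 1) a2 (a2 + 1) a3 (a3 + 1) p.

Definition sqdist3 (p q : pt3) : R :=
  (px p - px q) ^ 2 + (py p - py q) ^ 2 + (pz p - pz q) ^ 2.

Definition ball3 (S : pt3 -> Prop) : Prop :=
  exists (c : pt3) (rad : R), 0 < rad /\ forall p, S p <-> sqdist3 p c <= rad ^ 2.

Definition unit_ball3 (S : pt3 -> Prop) : Prop :=
  exists c : pt3, forall p, S p <-> sqdist3 p c <= 1.

Local Close Scope R_scope.

Definition two_interval_class := intersection_class two_interval.
Definition two_unit_interval_class := intersection_class two_unit_interval.
Definition axis_segment3_class := intersection_class axis_segment3.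
Definition box3_class := intersection_class box3.
Definition unit_cube3_class := intersection_class unit_cube3.
Definition ball3_class := intersection_class ball3.
Definition unit_ball3_class := intersection_class unit_ball3.

(* Main.v *)
(** All eight classes are served by a single family: the line graphs of finite
    subgraphs H of the cubic grid in which the edges are spread out enough for
    unit balls and unit cubes around the midpoints to meet only when the edges
    share an endpoint.

    H is a drawing of a bipartite graph G of girth 6 and minimum degree at least
    k + 2 (the flags of the affine plane over F_p without its vertical lines).
    Each vertex of G becomes a gadget, a straight segment of length D, and each
    edge of G becomes a road of length L much larger than D joining two gadgets.
    The robber never stops. While he runs along a road to a gadget W, the
    invariant is that he reaches every point of W before every cop. When he is
    about to enter W, each cop can spoil this invariant for at most one of the
    roads leaving W, because G has no cycle of length 4, so that one of the at
    least k + 1 roads ahead is good. The invariant is a comparison of the values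
    of a 1-Lipschitz potential, which decreases along the robber's route. *)
Require Import Defs.
From mathcomp Require Import all_boot all_algebra zify.
From Stdlib Require Import Reals Lra.

Set Implicit Arguments.
Unset Strict Implicit.
Unset Printing Implicit Defensive.

(** * Evasion from an invariant of the game *)

Section Evasion.

Variables (T : finType) (e : rel T) (k : nat) (safe : ('I_k -> T) -> T -> Prop).

Hypothesis safe_start :
  forall c, exists r, (forall i, c i <> r) /\ safe c r.
Hypothesis safe_move : forall c r c', safe c r -> (forall i, step e (c i) (c' i)) ->
  (forall i, c' i <> r) /\
  exists r', [/\ step e r r', forall i, c' i <> r' & safe c' r'].

Lemma cop_win_unsafe c r : cop_win e c r -> ~ safe c r.
Proof.
(* [cop_win] recurs under disjunctions, where the generated induction principle gives no hypothesis;
   hence the explicit fixpoint. *)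
move: c r; fix IH 3 => c r [{}c {}r c' cc' win] /safe_move/(_ cc') [nr [r' [rr' nr' sr']]].
case: win => [[i ci]|/(_ r' rr') [[i ci]|win]]; [exact: nr ci|exact: nr' ci|].
exact: IH win sr'.
Qed.

Lemma evasion : ~ cops_win e k.
Proof.
case=> c win; have [r [nr sr]] := safe_start c.
case: (win r) => [[i ci]|/cop_win_unsafe]; [exact: nr ci|exact].
Qed.

End Evasion.

(** * Inclusions between the graph classes *)

Lemma line_graph_two_unit_interval (T : finType) (e : rel T) :
  line_graph_class e -> two_unit_interval_class e.
Proof.
case=> U [ends [ends2 [_ adj]]].
(* Each vertex of the root graph owns a unit interval, the factor 2 keeping them disjoint; an edge
   takes the intervals of its two ends. *)
pose a (u : U) := (2 * INR (enum_rank u))%R.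
exists (fun x t => exists2 u, u \in ends x & closed_interval (a u) (a u + 1) t).
split=> [x|x y nxy].
  have /eqP/cards2P[u [v [_ ->]]] := ends2 x.
  exists (a u), (a v); move=> t; split=> [[w]|[tu|tv]].
  - by rewrite !inE => /orP[] /eqP -> tw; [left|right].
  - by exists u; rewrite // !inE eqxx.
  - by exists v; rewrite // !inE eqxx orbT.
rewrite adj //; split=> [/set0Pn[u /setIP[ux uy]]|[t [[u ux tu] [v vy tv]]]].
  by exists (a u); split; exists u => //; split; lra.
suff uv : u = v by apply/set0Pn; exists u; rewrite inE ux uv vy.
apply/enum_rank_inj/val_inj; move: tu tv; rewrite /closed_interval /a /=.
move: (val _) (val _) => m n mt nt.
have [mn|nm|//] := ltngtP m n.
  by have := le_INR m.+1 n (elimT leP mn); rewrite S_INR; lra.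
by have := le_INR n.+1 m (elimT leP nm); rewrite S_INR; lra.
Qed.

Lemma two_unit_interval_two_interval (T : finType) (e : rel T) :
  two_unit_interval_class e -> two_interval_class e.
Proof.
case=> S [S2 adj]; exists S; split=> // x.
have [a [b ab]] := S2 x.
by exists a, (a + 1)%R, b, (b + 1)%R; split; [lra|split=> //; lra].
Qed.

Lemma axis_segment_box (T : finType) (e : rel T) :
  axis_segment3_class e -> box3_class e.
Proof.
case=> S [S2 adj]; exists S; split=> // x.
have [a1 [b1 [a2 [b2 [a3 [b3 [h1 [h2 [h3 [_ h]]]]]]]]]] := S2 x.
by exists a1, b1, a2, b2, a3, b3.
Qed.

Lemma unit_ball_ball (T : finType) (e : rel T) :
  unit_ball3_class e -> ball3_class e.
Proof.
case=> S [S2 adj]; exists S; split=> // x.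
have [c hc] := S2 x.
by exists c, 1%R; split=> [|p]; [lra|rewrite hc pow1].
Qed.

Lemma INR_leq m n : (INR m <= INR n)%R <-> m <= n.
Proof.
split=> [mn|/leP]; last exact: le_INR.
by apply/leP/INR_le.
Qed.

Lemma INR_addn m n : INR (m + n) = (INR m + INR n)%R.
Proof. exact: plus_INR. Qed.

(** * Intersections of real boxes *)

Section RealBoxes.
Local Open Scope R_scope.

Lemma interval_meet a b a' b' : a <= b -> a' <= b' ->
  (exists t, closed_interval a b t /\ closed_interval a' b' t) <->
  a <= b' /\ a' <= b.
Proof.
move=> ab ab'; rewrite /closed_interval; split=> [[t] [] [] * |[h h']]; first lra.
have [aa|aa] := Rle_lt_dec a a'; [exists a'|exists a]; lra.
Qed.

Lemma box_meet a1 b1 a2 b2 a3 b3 a1' b1' a2' b2' a3' b3' :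
  a1 <= b1 -> a2 <= b2 -> a3 <= b3 -> a1' <= b1' -> a2' <= b2' -> a3' <= b3' ->
  (exists p, in_box a1 b1 a2 b2 a3 b3 p /\ in_box a1' b1' a2' b2' a3' b3' p) <->
  (a1 <= b1' /\ a1' <= b1) /\ (a2 <= b2' /\ a2' <= b2) /\ (a3 <= b3' /\ a3' <= b3).
Proof.
move=> h1 h2 h3 h1' h2' h3'.
split=> [[p] [] [p1 [p2 p3]] [p1' [p2' p3']]|].
  split; [|split]; apply/interval_meet => //.
  - by exists (px p).
  - by exists (py p).
  - by exists (pz p).
case=> /(interval_meet h1 h1')[x [x1 x2]] [].
move=> /(interval_meet h2 h2')[y [y1 y2]] /(interval_meet h3 h3')[z [z1 z2]].
by exists (x, y, z).
Qed.

End RealBoxes.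

(** * Spread-out grid graphs and their geometric representations *)

Definition share (A : eqType) (p q p' q' : A) : bool :=
  [|| p == p', p == q', q == p' | q == q'].

Lemma share_sym (A : eqType) (p q p' q' : A) : share p q p' q' = share p' q' p q.
Proof.
rewrite /share (eq_sym p' p) (eq_sym p' q) (eq_sym q' p) (eq_sym q' q).
by rewrite (orbCA (q == p')).
Qed.

Definition natdist m n := (m - n) + (n - m).

Section GridGraph.

Local Notation gpt := (nat * nat * nat)%type.

(* The evenness conditions keep edges without a common endpoint apart, so that
   the unit balls and unit cubes around the midpoints intersect exactly for
   edges that share an endpoint. *)
Definition grid_edge (p q : gpt) : Prop :=
  [\/ q = (p.1.1.+1, p.1.2, p.2) /\ ~~ odd p.1.2 && ~~ odd p.2,
      q = (p.1.1, p.1.2.+1, p.2) /\ ~~ odd p.1.1 && ~~ odd p.2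
    | q = (p.1.1, p.1.2, p.2.+1) /\ ~~ odd p.1.1 && ~~ odd p.1.2].

(* The sum of the endpoints of an edge is twice its midpoint. *)
Definition dmid (p q : gpt) : gpt := (p.1.1 + q.1.1, p.1.2 + q.1.2, p.2 + q.2).

(** For doubled coordinates: at most 1 apart before doubling. *)
Definition close (m n : nat) : Prop := m <= n + 2 /\ n <= m + 2.

Lemma even_close a b : ~~ odd a -> ~~ odd b -> close (a + a) (b + b) -> a = b.
Proof. by rewrite /close; lia. Qed.

Lemma edge_close a b : close (a + a.+1) (b + b.+1) -> [\/ b = a, b = a.+1 | a = b.+1].
Proof.
rewrite /close => ab; have : b = a \/ b = a.+1 \/ a = b.+1 by lia.
by case=> [|[]]; [exact: Or31|exact: Or32|exact: Or33].
Qed.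

Lemma edge_even_close a b : close (a + a.+1) (b + b) -> b = a \/ b = a.+1.
Proof. by rewrite /close; lia. Qed.

Lemma closeC m n : close m n -> close n m.
Proof. by case. Qed.

(** A doubled midpoint is a multiple of 4 across its edge and odd along it. So closeness equates two
    transverse coordinates, and puts a transverse coordinate at one of the two ends of an edge
    running along that axis. *)
Lemma close_share p q p' q' : grid_edge p q -> grid_edge p' q' ->
  let c := dmid p q in let c' := dmid p' q' in
  close c.1.1 c'.1.1 -> close c.1.2 c'.1.2 -> close c.2 c'.2 -> share p q p' q'.
Proof.
rewrite /share; case: p p' => [[x y] z] [[x' y'] z'].
case=> -[->] /= /andP[e1 e2]; case=> -[->] /= /andP[e1' e2'] hx hy hz.
- move: hx => /edge_close[] ->; rewrite (even_close e1 e1' hy) (even_close e2 e2' hz);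
    by rewrite !eqxx ?orbT.
- case/edge_even_close: hx => ->; case/closeC/edge_even_close: hy => ->;
    by rewrite (even_close e2 e2' hz) !eqxx ?orbT.
- case/edge_even_close: hx => ->; case/closeC/edge_even_close: hz => ->;
    by rewrite (even_close e1 e2' hy) !eqxx ?orbT.
- case/closeC/edge_even_close: hx => ->; case/edge_even_close: hy => ->;
    by rewrite (even_close e2 e2' hz) !eqxx ?orbT.
- move: hy => /edge_close[] ->; rewrite (even_close e1 e1' hx) (even_close e2 e2' hz);
    by rewrite !eqxx ?orbT.
- case/edge_even_close: hy => ->; case/closeC/edge_even_close: hz => ->;
    by rewrite (even_close e1 e1' hx) !eqxx ?orbT.
- case/closeC/edge_even_close: hx => ->; case/edge_even_close: hz => ->;
    by rewrite (even_close e2 e1' hy) !eqxx ?orbT.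
- case/closeC/edge_even_close: hy => ->; case/edge_even_close: hz => ->;
    by rewrite (even_close e1 e1' hx) !eqxx ?orbT.
- move: hz => /edge_close[] ->; rewrite (even_close e1 e1' hx) (even_close e2 e2' hy);
    by rewrite !eqxx ?orbT.
Qed.

(** After doubling, each midpoint is one unit along an axis from the shared endpoint. *)
Lemma share_taxi p q p' q' : grid_edge p q -> grid_edge p' q' ->
  share p q p' q' ->
  let c := dmid p q in let c' := dmid p' q' in
  natdist c.1.1 c'.1.1 + natdist c.1.2 c'.1.2 + natdist c.2 c'.2 <= 2.
Proof.
case: p p' => [[x y] z] [[x' y'] z'].
by case=> -[-> _] /=; case=> -[-> _] /= /or4P[] /eqP[] *; subst;
  rewrite /natdist; lia.
Qed.

Lemma share_cube p q p' q' : grid_edge p q -> grid_edge p' q' ->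
  let c := dmid p q in let c' := dmid p' q' in
  share p q p' q' <-> close c.1.1 c'.1.1 /\ close c.1.2 c'.1.2 /\ close c.2 c'.2.
Proof.
move=> e e' c c'; split=> [/(share_taxi e e')|[hx [hy hz]]]; last exact: close_share.
by rewrite -/c -/c' /natdist /close; lia.
Qed.

Lemma grid_edge_bounds p q : grid_edge p q ->
  [/\ p.1.1 <= q.1.1 <= p.1.1.+1, p.1.2 <= q.1.2 <= p.1.2.+1 & p.2 <= q.2 <= p.2.+1].
Proof. by case=> -[-> _] /=; rewrite !leqnn !leqnSn. Qed.

Lemma share_box p q p' q' : grid_edge p q -> grid_edge p' q' ->
  share p q p' q' <->
  (p.1.1 <= q'.1.1 /\ p'.1.1 <= q.1.1) /\ (p.1.2 <= q'.1.2 /\ p'.1.2 <= q.1.2) /\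
  (p.2 <= q'.2 /\ p'.2 <= q.2).
Proof.
move=> e e'; have [b1 b2 b3] := grid_edge_bounds e.
have [b1' b2' b3'] := grid_edge_bounds e'.
split=> [/or4P[] /eqP h|[h1 [h2 h3]]].
- by move: b1 b2 b3 b1' b2' b3'; rewrite h; lia.
- by move: b1 b2 b3 b1' b2' b3'; rewrite h; lia.
- by move: b1 b2 b3 b1' b2' b3'; rewrite h; lia.
- by move: b1 b2 b3 b1' b2' b3'; rewrite h; lia.
apply/share_cube => //; rewrite /close /dmid /=.
by split; [|split]; lia.
Qed.

Lemma INR_natdist m n : INR (natdist m n) = Rabs (INR m - INR n).
Proof.
rewrite /natdist INR_addn; have [mn|/ltnW mn] := leqP m n.
  rewrite (eqP mn) minus_INR; last exact/leP.
  by rewrite Rabs_minus_sym Rabs_pos_eq /=; move/INR_leq: mn; lra.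
rewrite (eqP mn) minus_INR; last exact/leP.
by rewrite Rabs_pos_eq /=; move/INR_leq: mn; lra.
Qed.

Variables (T : finType) (lo hi : T -> gpt) (e : rel T).
Hypothesis edgeP : forall x, grid_edge (lo x) (hi x).
Hypothesis edge_inj : forall x y, lo x = lo y -> hi x = hi y -> x = y.
Hypothesis eE : forall x y, e x y = (x != y) && share (lo x) (hi x) (lo y) (hi y).

Lemma grid_adj x y : x <> y -> e x y = share (lo x) (hi x) (lo y) (hi y).
Proof. by move=> /eqP nxy; rewrite eE nxy. Qed.

Lemma grid_simple : simple_graph e.
Proof.
split=> [x y|x]; last by rewrite eE eqxx.
by rewrite !eE eq_sym share_sym.
Qed.

Lemma grid_line_graph : line_graph_class e.
Proof.
pose s := undup (codom lo ++ codom hi).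
have los x : lo x \in s by rewrite mem_undup mem_cat codom_f.
have his x : hi x \in s by rewrite mem_undup mem_cat codom_f orbT.
pose ends x : {set seq_sub s} := [set SeqSub (los x); SeqSub (his x)].
have lohi x : lo x != hi x.
  by case: (edgeP x) => -[-> _]; case: (lo x) => [[a b] c] /=; rewrite !xpair_eqE; lia.
exists (seq_sub s), ends; split=> [x|].
  by rewrite cards2 -val_eqE /= lohi.
split=> [x y /setP exy|x y /grid_adj ->].
  have := exy (SeqSub (los x)); have := exy (SeqSub (his x)).
  rewrite !inE -!val_eqE /= !eqxx !orbT; move: (edgeP x) (edgeP y) (@edge_inj x y).
  case: (lo x) (hi x) (lo y) (hi y) => [[a b] c] [[a' b'] c'] [[x1 y1] z1] [[x2 y2] z2].
  case=> -[[-> -> ->]] /= _; case=> -[[-> -> ->]] /= _ inj; rewrite !xpair_eqE => h h';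
    by apply: inj; congr (_, _, _); lia.
rewrite /share; split=> [|/set0Pn[u]].
  case/or4P=> /eqP h; apply/set0Pn.
  - by exists (SeqSub (los x)); rewrite !inE -!val_eqE /= eqxx h eqxx.
  - by exists (SeqSub (los x)); rewrite !inE -!val_eqE /= eqxx h eqxx orbT.
  - by exists (SeqSub (his x)); rewrite !inE -!val_eqE /= eqxx h eqxx orbT.
  - by exists (SeqSub (his x)); rewrite !inE -!val_eqE /= eqxx h eqxx !orbT.
rewrite !inE -!val_eqE /= => /andP[/orP[] /eqP -> /orP[] /eqP ->];
  by rewrite eqxx ?orbT.
Qed.

Lemma grid_axis_segment : axis_segment3_class e.
Proof.
have lehi x : [/\ (lo x).1.1 <= (hi x).1.1, (lo x).1.2 <= (hi x).1.2 & (lo x).2 <= (hi x).2].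
  by case: (edgeP x) => -[-> _] /=; split; lia.
exists (fun x => in_box (INR (lo x).1.1) (INR (hi x).1.1) (INR (lo x).1.2)
   (INR (hi x).1.2) (INR (lo x).2) (INR (hi x).2)); split=> [x|x y /grid_adj ->].
  have [/INR_leq h1 /INR_leq h2 /INR_leq h3] := lehi x.
  do 6 eexists; split; first exact: h1; split; first exact: h2; split; first exact: h3.
  by split=> //; case: (edgeP x) => -[-> _] /=; tauto.
have [/INR_leq h1 /INR_leq h2 /INR_leq h3] := lehi x.
have [/INR_leq h1' /INR_leq h2' /INR_leq h3'] := lehi y.
by rewrite box_meet // !INR_leq; apply: share_box.
Qed.

Lemma grid_unit_cube : unit_cube3_class e.
Proof.
pose a f x := (INR (f (dmid (lo x) (hi x))) / 2)%R.
pose fx (p : gpt) := p.1.1; pose fy (p : gpt) := p.1.2; pose fz (p : gpt) := p.2.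
have cmp f x y : (a f x <= a f y + 1)%R <->
    f (dmid (lo x) (hi x)) <= f (dmid (lo y) (hi y)) + 2.
  by rewrite -INR_leq INR_addn /a /=; lra.
exists (fun x => in_box (a fx x) (a fx x + 1) (a fy x) (a fy x + 1) (a fz x) (a fz x + 1)).
split=> [x|x y /grid_adj ->]; first by exists (a fx x), (a fy x), (a fz x).
rewrite box_meet; try lra; rewrite !cmp.
exact: (share_cube (edgeP x) (edgeP y)).
Qed.

Lemma grid_unit_ball : unit_ball3_class e.
Proof.
(* The drawing is doubled, so that unit balls meet when their centres are at most 2 apart. *)
pose ctr x : pt3 := let c := dmid (lo x) (hi x) in (INR c.1.1, INR c.1.2, INR c.2).
exists (fun x p => sqdist3 p (ctr x) <= 1)%R; split=> [x|x y /grid_adj ->].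
  by exists (ctr x).
split=> [sh|[p []]].
  have /INR_leq h := share_taxi (edgeP x) (edgeP y) sh; move: h.
  rewrite 2!INR_addn !INR_natdist => taxi.
  exists ((px (ctr x) + px (ctr y)) / 2, (py (ctr x) + py (ctr y)) / 2,
    (pz (ctr x) + pz (ctr y)) / 2)%R.
  move: taxi; rewrite /sqdist3 /ctr /px /py /pz /=.
  set u := (_ - _)%R; set v := (_ - _)%R; set w := (_ - _)%R => h.
  have ? := pow2_abs u; have ? := pow2_abs v; have ? := pow2_abs w.
  have ? := Rabs_pos u; have ? := Rabs_pos v; have ? := Rabs_pos w.
  have : (u ^ 2 + v ^ 2 + w ^ 2 <= 4)%R by nra.
  rewrite /u /v /w; split; nra.
move=> px py; apply/share_cube => //; rewrite /close -!INR_leq.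
move: px py; rewrite /sqdist3 /ctr /Defs.px /Defs.py /Defs.pz.
rewrite !(INR_addn _ 2) (_ : INR 2 = 2%R) //.
move: (INR (dmid _ _).1.1) (INR (dmid (lo y) _).1.1) (INR (dmid _ _).1.2)
  (INR (dmid (lo y) _).1.2) (INR (dmid _ _).2) (INR (dmid (lo y) _).2).
move=> a1 b1 a2 b2 a3 b3 /= h1 h2.
(* Parallelogram identity: |c - c'|^2 + |2p - c - c'|^2 = 2|p - c|^2 + 2|p - c'|^2 <= 4. *)
have ? := pow2_ge_0 (2 * p.1.1 - a1 - b1).
have ? := pow2_ge_0 (2 * p.1.2 - a2 - b2).
have ? := pow2_ge_0 (2 * p.2 - a3 - b3).
have : ((a1 - b1) ^ 2 + (a2 - b2) ^ 2 + (a3 - b3) ^ 2 <= 4)%R by lra.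
move=> h.
have le2 u : (u ^ 2 <= 4 -> - 2 <= u <= 2)%R by move=> ?; split; nra.
have := pow2_ge_0 (a1 - b1); have := pow2_ge_0 (a2 - b2).
have := pow2_ge_0 (a3 - b3) => s3 s2 s1.
have [|? ?] := le2 (a1 - b1)%R; first lra.
have [|? ?] := le2 (a2 - b2)%R; first lra.
have [|? ?] := le2 (a3 - b3)%R; first lra.
by repeat split; lra.
Qed.

End GridGraph.

(** Otherwise, mapping each element of [A] to an index that excludes it would be injective. *)
Lemma pigeonhole (k : nat) (J : finType) (A : {set J}) (R : 'I_k -> pred J) :
  k < #|A| ->
  (forall n, {in A &, forall i1 i2, R n i1 -> R n i2 -> i1 = i2}) ->
  exists2 i, i \in A & forall n, ~~ R n i.
Proof.
move=> kA Runiq; pose f i := [pick n | R n i].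
have [/exists_inP[i iA /forallP nR]|] := boolP [exists i in A, [forall n, ~~ R n i]].
  by exists i.
rewrite negb_exists_in => /forall_inP AR.
have fA i : i \in A -> exists2 n, R n i & f i = Some n.
  move=> /AR; rewrite negb_forall => /existsP[n]; rewrite negbK /f => Rni.
  by case: pickP => [m Rmi|/(_ n)]; [exists m|rewrite Rni].
suff : #|A| <= k by rewrite leqNgt kA.
rewrite -(@card_in_imset _ _ f) => [|i1 i2 i1A i2A].
  have Somek : #|[set Some n | n : 'I_k]| = k.
    by rewrite card_imset ?cardsT ?card_ord //; apply: Some_inj.
  apply: leq_trans (_ : _ <= #|[set Some n | n : 'I_k]|) _; last by rewrite Somek.
  apply/subset_leq_card/subsetP => _ /imsetP[i /fA[n _ ->] ->].
  exact: imset_f.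
have [n Rn ->] := fA _ i1A; have [m Rm ->] := fA _ i2A => -[nm].
by apply: (Runiq m) => //; rewrite -nm.
Qed.

(** * The graph of gadgets and roads *)

Section Roads.

(* The vertices of the bipartite graph are the pairs [(b, q)], and [inc b j] is
   the end of the edge [j] on the side [b].  A cell is an edge of the drawing, in a
   gadget ([inl]) or on a road ([inr]), and a spot is an endpoint of a cell. *)
Variables (Q J : finType) (inc : bool -> J -> Q) (D L : nat) (port : J -> nat).

Local Notation site := (bool * Q * nat)%type.
Local Notation spot := (site + J * nat)%type.
Local Notation cell := (bool * Q * 'I_D + J * 'I_L)%type.

(** The ends of a road are named as gadget spots, so that sharing an endpoint is an equality
    test. *)
Definition road_spot (j : J) (s : nat) : spot :=
  if s == 0 then inl (false, inc false j, port j)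
  else if s == L then inl (true, inc true j, port j) else inr (j, s).

Definition cell_lo (c : cell) : spot :=
  match c with inl (v, x) => inl (v, x : nat) | inr (j, s) => road_spot j s end.

Definition cell_hi (c : cell) : spot :=
  match c with inl (v, x) => inl (v, x.+1) | inr (j, s) => road_spot j s.+1 end.

Definition cell_share (x y : cell) : bool :=
  share (cell_lo x) (cell_hi x) (cell_lo y) (cell_hi y).

Definition road_graph : rel cell := fun x y => (x != y) && cell_share x y.

Hypothesis port_lt : forall j, port j < D.
Hypothesis long : 3 * D + 10 <= L.

Lemma road_spot_end b j :
  road_spot j (if b then L else 0) = inl (b, inc b j, port j).
Proof.
case: b; rewrite /road_spot // eqxx; case: eqP => // L0.
by have := port_lt j; move: long; rewrite L0; lia.
Qed.

Section Connected.

(** Connectedness of the bipartite graph, in a form that applies to the predicate of being connected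
    to a fixed gadget. *)
Hypothesis inc_conn : forall A : pred (bool * Q),
  (forall j, A (false, inc false j) = A (true, inc true j)) -> forall u v, A u = A v.

Lemma road_connect1 x y : cell_share x y -> connect road_graph x y.
Proof.
move=> xy; have [->|nxy] := eqVneq x y; first exact: connect0.
by apply: connect1; rewrite /road_graph nxy.
Qed.

Lemma road_connected_graph : 0 < #|J| -> connected_graph road_graph.
Proof.
move=> /card_gt0P[j0 _].
have D0 : 0 < D by have := port_lt j0; lia.
have L0 : 0 < L by lia.
have csym : connect_sym road_graph.
  by apply: sym_connect_sym => x y; rewrite /road_graph eq_sym /cell_share share_sym.
pose g (v : bool * Q) (x : 'I_D) : cell := inl (v, x).
pose g0 v := g v (Ordinal D0).
have gadget v x : connect road_graph (g0 v) (g v x).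
  case: x => x; elim: x => [|x IH] xD.
    by rewrite (_ : Ordinal xD = Ordinal D0) //; apply: val_inj.
  apply: connect_trans (IH (ltnW xD)) _; apply: road_connect1.
  by rewrite /cell_share /share /= eqxx !orbT.
have road0 j : connect road_graph (g0 (false, inc false j)) (inr (j, Ordinal L0)).
  apply: connect_trans (gadget _ (Ordinal (port_lt j))) _; apply: road_connect1.
  by rewrite /cell_share /share /= (road_spot_end false) eqxx.
have road j s : connect road_graph (g0 (false, inc false j)) (inr (j, s)).
  case: s => s; elim: s => [|s IH] sL.
    by rewrite (_ : Ordinal sL = Ordinal L0) //; apply: val_inj.
  apply: connect_trans (IH (ltnW sL)) _; apply: road_connect1.
  by rewrite /cell_share /share /= eqxx !orbT.
have roadL j : connect road_graph (g0 (false, inc false j)) (g0 (true, inc true j)).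
  have L1 : L.-1 < L by lia.
  apply: connect_trans (road j (Ordinal L1)) _.
  rewrite csym; apply: connect_trans (gadget _ (Ordinal (port_lt j))) _.
  apply: road_connect1.
  by rewrite /cell_share /share /= (prednK L0) (road_spot_end true) eqxx orbT.
have sites u v : connect road_graph (g0 u) (g0 v).
  rewrite (inc_conn (A := fun u => connect road_graph (g0 u) (g0 v)) _ u v) ?connect0 //.
  by move=> j; apply: same_connect.
have toall u c : connect road_graph (g0 u) c.
  case: c => [[v x]|[j s]]; first exact: connect_trans (sites _ _) (gadget v x).
  exact: connect_trans (sites _ _) (road j s).
split=> [|x y]; first by apply/card_gt0P; exists (g0 (false, inc false j0)).
apply: connect_trans (toall (false, inc false j0) y).
by rewrite csym.
Qed.

End Connected.

(** * The potential and the robber's route *)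

Hypothesis inc_simple : forall b i j,
  inc b i = inc b j -> inc (~~ b) i = inc (~~ b) j -> i = j.

Hypothesis inc_no4 : forall b j1 j2 j3 j4,
  inc b j1 = inc b j2 -> inc (~~ b) j2 = inc (~~ b) j3 ->
  inc b j3 = inc b j4 -> inc (~~ b) j4 = inc (~~ b) j1 -> j1 = j2 \/ j2 = j3.

(** In the bipartite graph, [(~~ b, q)] is a neighbour of the target of [i]. *)
Definition adjacent_to b i (q : Q) : bool :=
  [exists j, (inc (~~ b) j == q) && (inc b j == inc b i)].

(* The potential for a robber heading along the road [i] to its end [b]: up to
   truncation far away, the minimum over the points [x] of the target gadget of
   the distance to [x], minus the distance from [port i] to [x], plus [D]. *)
Definition site_pot b i (p : site) : nat :=
  let: (b', q, x) := p in
  if b' == b then if q == inc b i then D - natdist x (port i) else 2 * L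
  else if q == inc (~~ b) i then D + L + natdist x (port i)
  else if adjacent_to b i q then L else 2 * L.

Definition port_pot b i b' j := site_pot b i (b', inc b' j, port j).

Definition road_pot b i j s : nat :=
  minn (port_pot b i false j + s) (port_pot b i true j + (L - s)).

Definition spot_pot b i (p : spot) : nat :=
  match p with inl v => site_pot b i v | inr (j, s) => road_pot b i j s end.

(** Twice the mean over the cell, to stay in [nat]. *)
Definition pot b i (c : cell) := spot_pot b i (cell_lo c) + spot_pot b i (cell_hi c).

Definition from_end (b : bool) s := if b then L - s else s.

Lemma road_potE b' b i j s : road_pot b i j s =
  minn (port_pot b i b' j + from_end b' s) (port_pot b i (~~ b') j + from_end (~~ b') s).
Proof. by case: b'; rewrite /road_pot // minnC. Qed.

Lemma natdist_lt i j : natdist (port i) (port j) < D.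
Proof. by rewrite /natdist; have := port_lt i; have := port_lt j; lia. Qed.

Lemma natdistxx n : natdist n n = 0. Proof. by rewrite /natdist; lia. Qed.

Lemma port_pot_target b i j : inc b j = inc b i ->
  port_pot b i b j = D - natdist (port j) (port i).
Proof. by rewrite /port_pot /site_pot !eqxx => ->; rewrite eqxx. Qed.

Lemma port_pot_origin b i j : inc (~~ b) j = inc (~~ b) i ->
  port_pot b i (~~ b) j = D + L + natdist (port j) (port i).
Proof. by rewrite /port_pot /site_pot; case: b => /= ->; rewrite eqxx. Qed.

(** This makes [road_pot] agree with [site_pot] at both ends of a road. Along [i] the gap is exactly
    [L]; on the other roads into the target, the value [L] of the [adjacent_to] sites keeps it small
    enough. *)
Lemma port_pot_gap b i b' j : port_pot b i b' j <= port_pot b i (~~ b') j + L.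
Proof.
have ltD := natdist_lt j i.
suff : port_pot b i b j <= port_pot b i (~~ b) j + L /\
       port_pot b i (~~ b) j <= port_pot b i b j + L.
  by case: b b' => -[] //= [].
have [jw|jw] := eqVneq (inc b j) (inc b i).
  have [jv|jv] := eqVneq (inc (~~ b) j) (inc (~~ b) i).
    by rewrite (inc_simple jw jv) port_pot_target // port_pot_origin // natdistxx; lia.
  rewrite port_pot_target // {1 2}/port_pot /site_pot (negbTE jv).
  have -> : adjacent_to b i (inc (~~ b) j) by apply/existsP; exists j; rewrite jw !eqxx.
  by case: b {jw jv} => /=; lia.
rewrite /port_pot /site_pot eqxx (negbTE jw).
by case: b {jw} => /=; case: ifP => _; [|case: ifP|..|case: ifP]; lia.
Qed.

Lemma road_spot_pot b i j s : s <= L -> spot_pot b i (road_spot j s) = road_pot b i j s.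
Proof.
move=> sL; have := port_pot_gap b i false j; have := port_pot_gap b i true j => /= g1 g2.
rewrite /road_spot; case: eqP => [->|s0].
  by rewrite /spot_pot -/(port_pot b i false j) /road_pot; lia.
case: eqP => [->|//].
by rewrite /spot_pot -/(port_pot b i true j) /road_pot; lia.
Qed.

Lemma pot_site b i v (x : 'I_D) :
  pot b i (inl (v, x)) = site_pot b i (v, x : nat) + site_pot b i (v, x.+1).
Proof. by []. Qed.

Lemma pot_road b i j (s : 'I_L) :
  pot b i (inr (j, s)) = road_pot b i j s + road_pot b i j s.+1.
Proof. by rewrite /pot /= !road_spot_pot // ltnW. Qed.

Lemma spot_pot_cell b i c :
  spot_pot b i (cell_lo c) <= spot_pot b i (cell_hi c) + 1 /\
  spot_pot b i (cell_hi c) <= spot_pot b i (cell_lo c) + 1.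
Proof.
case: c => [[[b' q] x]|[j s]] /=; last first.
  by have sL := ltn_ord s; rewrite !road_spot_pot /road_pot //; lia.
by rewrite /natdist; do !case: ifP => _; lia.
Qed.

(** Each sum is within 1 of twice the value at the shared spot. *)
Lemma pot_step b i x y : step road_graph x y -> pot b i x <= pot b i y + 2.
Proof.
case=> [->|/andP[_]]; first by lia.
have := spot_pot_cell b i x; have := spot_pot_cell b i y; rewrite /pot.
by move=> ? ? /or4P[] /eqP/(congr1 (spot_pot b i)); lia.
Qed.

(** The target gadget belongs to the next route, as its origin. *)
Definition on_route b (i : J) (c : cell) : bool :=
  match c with
  | inl (v, _) => v == (~~ b, inc (~~ b) i)
  | inr (j, _) => j == i
  end.

(* The cell [s] of a road is its last one in the direction of end [b]. *)
Definition is_last (b : bool) (s : nat) : bool := if b then s.+1 == L else s == 0.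

Lemma road_pot_own b i s : s <= L -> road_pot b i i s = D + from_end b s.
Proof.
move=> sL; rewrite (road_potE b) port_pot_target // port_pot_origin // natdistxx.
by rewrite /from_end; case: b; lia.
Qed.

Lemma last_spot b j (s : 'I_L) : is_last b s ->
  (if b then cell_hi (inr (j, s)) else cell_lo (inr (j, s))) = inl (b, inc b j, port j).
Proof. by rewrite -road_spot_end; case: b => /= /eqP ->. Qed.

Lemma last_share b j (x : 'I_D) (s : 'I_L) : is_last b s ->
  (x == port j :> nat) || (x.+1 == port j) ->
  cell_share (inl (b, inc b j, x)) (inr (j, s)).
Proof.
move=> /(last_spot j) sb xp; rewrite /cell_share /share.
by case: b sb => /= ->; case/orP: xp => /eqP ->; rewrite !eqxx ?orbT.
Qed.

(** The distance sum is 1 exactly on the cells that touch the port, from which the road [j] can be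
    entered. *)
Lemma gadget_step b j (x : 'I_D) : let v := (b, inc b j) in let p := port j in
  (exists2 y : 'I_D, cell_share (inl (v, x)) (inl (v, y)) &
     natdist y p + natdist y.+1 p + 2 = natdist x p + natdist x.+1 p) \/
  (exists s : 'I_L, [/\ cell_share (inl (v, x)) (inr (j, s)), is_last b s
     & natdist x p + natdist x.+1 p = 1]).
Proof.
move=> v p; have xD := ltn_ord x; have pD := port_lt j.
have Llt : (if b then L.-1 else 0) < L by case: b {v}; lia.
have [xp|xp] : (x == p :> nat) || (x.+1 == p) \/ ~~ ((x == p :> nat) || (x.+1 == p)).
- by case: (_ || _); [left|right].
- right; exists (Ordinal Llt).
  have sb : is_last b (Ordinal Llt) by rewrite /is_last /=; case: b {v} Llt; lia.
  by split=> //; [exact: last_share|move: xp; rewrite /natdist; lia].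
left; have [px|px] := ltnP p x.
  have yD : x.-1 < D by lia.
  exists (Ordinal yD); last by rewrite /natdist /=; lia.
  by rewrite /cell_share /share /= (ltn_predK px) eqxx !orbT.
have yD : x.+1 < D by lia.
exists (Ordinal yD); last by rewrite /natdist /=; lia.
by rewrite /cell_share /share /= eqxx !orbT.
Qed.

Lemma share_graph b i x y : cell_share x y -> pot b i y + 2 = pot b i x -> road_graph x y.
Proof.
by rewrite /road_graph => -> xy; rewrite andbT; apply/eqP => eq; move: xy; rewrite eq; lia.
Qed.

Lemma pot_origin b i (x : 'I_D) : pot b i (inl (~~ b, inc (~~ b) i, x)) =
  2 * D + 2 * L + (natdist x (port i) + natdist x.+1 (port i)).
Proof. by rewrite pot_site /site_pot !eqxx; case: b => /=; lia. Qed.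

Lemma pot_own b i (s : 'I_L) :
  pot b i (inr (i, s)) = 2 * D + (from_end b s + from_end b s.+1).
Proof. by rewrite pot_road !road_pot_own // 1?ltnW //; lia. Qed.

(** The robber descends by 2 per step, as fast as [pot_step] lets any cop descend. The excluded
    value is that of the last cell of the road, whose spots have values [D + 1] and [D]. *)
Lemma descend b i c : on_route b i c -> pot b i c != 2 * D + 1 ->
  exists r, [/\ cell_share c r, on_route b i r & pot b i r + 2 = pot b i c].
Proof.
case: c => [[v x]|[j s]] /= /eqP ->.
  move=> _; have [[y xy py]|[s [xs sb px]]] := gadget_step (~~ b) i x.
    exists (inl (~~ b, inc (~~ b) i, y)); split=> //=.
    by rewrite !pot_origin; lia.
  exists (inr (i, s)); split=> //=.
  rewrite pot_origin pot_own; have := ltn_ord s; move: sb.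
  by rewrite /is_last /from_end; case: (b) => /=; lia.
rewrite pot_own /from_end; have sL := ltn_ord s; case: b => ne.
  have yL : s.+1 < L by lia.
  exists (inr (i, Ordinal yL)); split=> //=; last by rewrite pot_own /=; lia.
  by rewrite /cell_share /share /= eqxx !orbT.
have yL : s.-1 < L by lia.
exists (inr (i, Ordinal yL)); split=> //=; last by rewrite pot_own /=; lia.
have s0 : 0 < s by lia.
by rewrite /cell_share /share /= (prednK s0) eqxx !orbT.
Qed.

Lemma at_last b i c : on_route b i c -> pot b i c = 2 * D + 1 ->
  exists2 s, c = inr (i, s) & is_last b s.
Proof.
case: c => [[[b' q] x]|[j s]] /= /eqP.
  by case=> -> ->; rewrite pot_origin; lia.
move=> ->; rewrite pot_own /from_end => h.
by exists s => //; rewrite /is_last; case: b h; have := ltn_ord s; lia.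
Qed.

(* The cop [c] may keep a robber who is at the gadget [(b, w)] from taking the
   road [i] safely. *)
Definition blocks b (w : Q) (i : J) (c : cell) : bool :=
  match c with
  | inl (b', q, _) =>
      if b' == b then (q != w) && adjacent_to (~~ b) i q else q == inc (~~ b) i
  | inr (j, _) =>
      if inc b j == w then j == i else adjacent_to (~~ b) i (inc b j)
  end.

(** A cop in a gadget opposite to [w], or on a road leaving [w], blocks only the road leading there.
    Any other cop counts as being at a site [q] on the side of [w]; if it blocked two roads, [w],
    [q] and their far ends would form a 4-cycle. *)
Lemma blocks_uniq b w i1 i2 c : inc b i1 = w -> inc b i2 = w ->
  blocks b w i1 c -> blocks b w i2 c -> i1 = i2.
Proof.
have adj_uniq q : inc b i1 = w -> inc b i2 = w -> q != w ->
    adjacent_to (~~ b) i1 q -> adjacent_to (~~ b) i2 q -> i1 = i2.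
  rewrite /adjacent_to negbK => w1 w2 qw /existsP[j1 /andP[/eqP q1 /eqP jw1]].
  move=> /existsP[j2 /andP[/eqP q2 /eqP jw2]].
  have [||||jj|ij] := @inc_no4 b j1 j2 i2 i1 _ _ _ _; try congruence.
  - by apply: (@inc_simple b); congruence.
  - by move: qw; rewrite -q2 ij w2 eqxx.
case: c => [[[b' q] x]|[j s]] /= w1 w2.
  case: ifP => _; first by case/andP=> qw a1 /andP[_]; apply: adj_uniq.
  by move=> /eqP -> /eqP; apply: inc_simple; rewrite w1.
case: eqP => [_ /eqP <- /eqP //|/eqP jw]; exact: adj_uniq.
Qed.

(* The robber is about to leave the road [i] at its end [b] and aims at the
   other end of the road [i'], which no unblocked cop can get to before him. *)
Lemma unblocked_pot b i i' c : inc b i' = inc b i -> 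
  2 * D + 5 <= pot b i c -> ~~ blocks b (inc b i) i' c ->
  2 * D + 2 * L + 2 * natdist (port i) (port i') + 5 <= pot (~~ b) i' c.
Proof.
move=> ii'; have ltD := natdist_lt i i'.
case: c => [[[b' q] x]|[j s]] /=.
  rewrite !pot_site /site_pot negbK.
  have [->|b'b] := eqVneq b' b.
    rewrite (_ : b == ~~ b = false); last by case: (b).
    (* In the gadget about to be entered the old potential is at most [2 * D], so no cop is
       there. *)
    rewrite ii'; have [->|qw] /= := eqVneq q (inc b i); first by lia.
    by move=> _ /negbTE ->; lia.
  have -> : b' = ~~ b by move: b'b; case: (b) (b') => -[].
  by rewrite eqxx => _ /negbTE ->; lia.
rewrite !pot_road (road_potE b) (road_potE b _ _ _ s.+1).
rewrite (road_potE b (~~ b)) (road_potE b (~~ b) _ _ s.+1).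
have sL := ltn_ord s.
have [jw|jw] := eqVneq (inc b j) (inc b i).
  (* The old potential bounds from below the cop's distance to [port j] in terms of
     [natdist (port j) (port i)]; the triangle inequality for the three ports concludes. *)
  move=> + ji; rewrite (port_pot_target jw).
  have := @port_pot_origin (~~ b) i' j; rewrite negbK jw ii' => /(_ erefl) ->.
  have -> : port_pot (~~ b) i' (~~ b) j = 2 * L.
    rewrite /port_pot /site_pot eqxx ifN //; apply: contra ji => /eqP ji.
    by apply/eqP/(@inc_simple b); rewrite ?jw.
  by move: (natdist_lt j i) (natdist_lt j i'); rewrite /natdist /from_end;
    case: (b); lia.
move=> _ nadj.
have -> : port_pot (~~ b) i' b j = 2 * L.
  rewrite /port_pot /site_pot negbK (_ : b == ~~ b = false); last by case: (b).
  by rewrite ii' (negbTE jw) (negbTE nadj).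
have -> : port_pot (~~ b) i' (~~ b) j = 2 * L.
  rewrite /port_pot /site_pot eqxx ifN //; apply: contra nadj => /eqP ji.
  by apply/existsP; exists j; rewrite negbK ji !eqxx.
by rewrite /from_end; case: (b); lia.
Qed.

Hypothesis port_inj : injective port.

(** * The robber's strategy *)

Section Strategy.

Variable k : nat.
Hypothesis degree : forall b q, k.+1 < #|[set j | inc b j == q]|.
Hypothesis many_sites : k < #|Q|.

(** The cops are to move, and the robber's reply [r'] is fixed in advance. Their move costs 2 of the
    margin 6; the remaining 4 keeps them off [r'], and off [r], whose potential is at most 2
    higher. *)
Definition escapes (c : 'I_k -> cell) (r : cell) : Prop :=
  exists b i r', [/\ step road_graph r r', on_route b i r' &
    forall n, pot b i r' + 6 <= pot b i (c n)].

Lemma turn b i i' (s : 'I_L) : inc b i' = inc b i -> i' != i -> is_last b s ->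
  exists r, [/\ cell_share (inr (i, s)) r, on_route (~~ b) i' r &
    pot (~~ b) i' r + 1 = 2 * D + 2 * L + 2 * natdist (port i) (port i')].
Proof.
move=> ii' ni sb.
have np : port i != port i' by rewrite eq_sym (inj_eq port_inj).
(* The cell at [port i] on the side of [port i']. *)
have pD := port_lt i; pose x := if port i < port i' then port i else (port i).-1.
have xD : x < D by rewrite /x; case: ifP; lia.
have xi : (x == port i) || (x.+1 == port i) by rewrite /x; case: ltnP; lia.
exists (inl (b, inc b i, Ordinal xD)); split.
- by rewrite /cell_share share_sym; apply: last_share.
- by rewrite /= negbK ii'.
have := pot_origin (~~ b) i' (Ordinal xD); rewrite negbK ii' => ->.
by rewrite /x /natdist /=; case: ltnP; lia.
Qed.

(** Raises the margin from 4 back to 6. Along a route the next cell is lower by 2. On the last cell,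
    of value [2 * D + 1], the margin 4 gives the premise [2 * D + 5] of [unblocked_pot], whose
    conclusion is 6 above the value in [turn]. *)
Lemma escape b i (c : 'I_k -> cell) r : on_route b i r ->
  (forall n, pot b i r + 4 <= pot b i (c n)) -> escapes c r.
Proof.
move=> ri far; have [end_|] := eqVneq (pot b i r) (2 * D + 1); last first.
  case/(descend ri)=> r' [rr' r'i pr']; exists b, i, r'; split=> // [|n].
    by right; apply: share_graph rr' pr'.
  by have := far n; lia.
have [s rs sb] := at_last ri end_; rewrite rs {ri} in far end_ *.
pose A := [set j | inc b j == inc b i] :\ i.
have [|n i1 i2|i' i'A ok] := @pigeonhole k _ A (fun n j => blocks b (inc b i) j (c n)).
- have := cardsD1 i [set j | inc b j == inc b i]; have := degree b (inc b i).
  by rewrite inE eqxx -/A; lia.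
- by rewrite !inE => /andP[_ /eqP ?] /andP[_ /eqP ?]; apply: blocks_uniq.
have /andP[ni /eqP ii'] : (i' != i) && (inc b i' == inc b i) by move: i'A; rewrite !inE.
have [r' [rr' r'i pr']] := turn ii' ni sb.
exists (~~ b), i', r'; split=> // [|n].
  right; rewrite /road_graph rr' andbT; apply: contraNneq ni => rr'_eq.
  by move: r'i; rewrite -rr'_eq /= eq_sym.
by have := unblocked_pot ii' _ (ok n); have := far n; lia.
Qed.

Lemma escapes_start c : exists r, (forall n, c n <> r) /\ escapes c r.
Proof.
(* For a site [w] that owns no cop, the robber starts on the last cell of a road into [(false, w)].
   Every cop then sits on spots of potential at least [L]. *)
pose owner (x : cell) := match x with inl (_, q, _) => q | inr (j, _) => inc false j end.
have [|n q1 q2 _ _ /eqP <- /eqP //|w _ nw] :=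
  @pigeonhole k _ setT (fun n q => owner (c n) == q); first by rewrite cardsT.
have /card_gt0P[i] : 0 < #|[set j | inc false j == w]| by apply: leq_trans (degree _ _).
rewrite inE => /eqP iw.
have L0 : 0 < L by lia.
pose r : cell := inr (i, Ordinal L0).
have far n : pot false i r + 4 <= pot false i (c n).
  have tf : (true == false) = false by [].
  rewrite pot_own /from_end /=; have := nw n; rewrite /owner -iw.
  case: (c n) => [[[[] q] x]|[j s]] => ni.
  - by rewrite pot_site /site_pot tf; case: (q == _); case: (adjacent_to false i q); lia.
  - by rewrite pot_site /site_pot eqxx (negbTE ni); lia.
  rewrite pot_road /road_pot /port_pot /site_pot eqxx tf (negbTE ni).
  have sL := ltn_ord s.
  by case: (inc true j == _); case: (adjacent_to false i (inc true j)); lia.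
exists r; split; last by apply: escape far; rewrite /= eqxx.
by move=> n cn; have := far n; rewrite cn; lia.
Qed.

Lemma escapes_move c r c' : escapes c r ->
  (forall n, step road_graph (c n) (c' n)) ->
  (forall n, c' n <> r) /\
  exists r', [/\ step road_graph r r', forall n, c' n <> r' & escapes c' r'].
Proof.
move=> [b [i [r' [rr' r'i far]]]] cc'.
have far' n : pot b i r' + 4 <= pot b i (c' n).
  by have := far n; have := pot_step b i (cc' n); lia.
split=> [n cr|]; first by have := far' n; have := pot_step b i rr'; rewrite cr; lia.
exists r'; split=> // [n cr|]; first by have := far' n; rewrite cr; lia.
exact: escape far'.
Qed.

Lemma road_graph_evasion : ~ cops_win road_graph k.
Proof. exact: evasion escapes_start escapes_move. Qed.

End Strategy.

End Roads.

(** * The drawing in the cubic grid *)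

Section Drawing.

Variables (Q J : finType) (inc : bool -> J -> Q).

Definition port (j : J) : nat := 2 * enum_rank j.
Definition gadget_length := 2 * #|J|.
Definition spread := #|Q| + gadget_length + 5.
(** The growth of y + z between the two lines of sites. *)
Definition road_length := 4 * spread.

Local Notation N := #|Q|.
Local Notation D := gadget_length.
Local Notation M := spread.
Local Notation L := road_length.
Local Notation spot := (bool * Q * nat + J * nat)%type.
Local Notation cell := (bool * Q * 'I_D + J * 'I_L)%type.

(* The gadgets are parallel to the first axis, over two antidiagonals of the plane of
   the other two coordinates.  The road [j] lies in the plane [x = port j] and
   climbs along [z] before it moves along [y]; the antidiagonals give
   all roads the same length. *)
Definition site_y (b : bool) (q : Q) : nat := (if b then 2 * M else 0) + 2 * enum_rank q.
Definition site_z (b : bool) (q : Q) : nat :=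
  (if b then 2 * M else 0) + 2 * (N - enum_rank q).

(** Truncated subtraction holds y fixed until the climb of length [z' - z] is over. *)
Definition road_point (j : J) (s : nat) : nat * nat * nat :=
  let y := site_y false (inc false j) in
  let z := site_z false (inc false j) in let z' := site_z true (inc true j) in
  (port j, y + (s - (z' - z)), minn (z + s) z').

Definition spot_point (p : spot) : nat * nat * nat :=
  match p with
  | inl (b, q, x) => (x, site_y b q, site_z b q)
  | inr (j, s) => road_point j s
  end.

(** The spots [inr (j, 0)] and [inr (j, L)] would be second names for gadget points. *)
Definition inner_spot (p : spot) : bool :=
  if p is inr (_, s) then 0 < s < L else true.

Lemma rank_lt (T : finType) (x : T) : enum_rank x < #|T|.
Proof. exact: ltn_ord. Qed.

Lemma port_lt j : port j < D.
Proof. by rewrite /port /D; have := rank_lt j; lia. Qed.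

Lemma port_inj : injective port.
Proof. by move=> i j ij; apply/enum_rank_inj/val_inj; move: ij; rewrite /port /=; lia. Qed.

Lemma road_length_long : 3 * D + 10 <= L.
Proof. by rewrite /L /M; lia. Qed.

Local Ltac unfold_sites :=
  rewrite /spot_point /road_point /site_y /site_z /L /M.

Lemma road_spot_point j s : s <= L ->
  spot_point (road_spot inc L port j s) = road_point j s.
Proof.
have := rank_lt (inc false j); have := rank_lt (inc true j).
rewrite /road_spot => ? ? sL; case: eqP => [->|_].
  by unfold_sites; congr (_, _, _); lia.
case: eqP => [->|//].
by unfold_sites; congr (_, _, _); lia.
Qed.

Lemma inner_road_spot j s : s <= L -> inner_spot (road_spot inc L port j s).
Proof.
by rewrite /road_spot; case: eqP => // s0; case: eqP => //= sL; lia.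
Qed.

(** With N = [#|Q|], y + z is 2N or 2N + L on gadgets and 2N + s on roads, strictly between for
    inner spots. Distinct roads differ in x. *)
Lemma spot_point_inj : {in inner_spot &, injective spot_point}.
Proof.
have off b q j s : 0 < s < L ->
    (site_y b q, site_z b q) <> ((road_point j s).1.2, (road_point j s).2).
  have := rank_lt (inc false j); have := rank_lt (inc true j); have := rank_lt q.
  by unfold_sites => /= ? ? ? sL []; case: b; lia.
case=> [[[b q] x]|[j s]] [[[b' q'] x']|[j' s']]; rewrite /in_mem /= => s0 s0'.
- have := rank_lt q; have := rank_lt q'; move=> ? ? [-> yy zz].
  have bb : b = b' by move: yy zz; unfold_sites; case: b b' => -[]; lia.
  rewrite bb; congr (inl (_, _, _)); apply/enum_rank_inj/val_inj.
  by move: yy; rewrite bb /site_y /=; lia.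
- by case=> _ yy zz; case: (off b q j' s' s0'); rewrite yy zz.
- by case=> _ yy zz; case: (off b' q' j s s0); rewrite -yy -zz.
case=> /port_inj -> yy zz; congr (inr (_, _)); move: yy zz.
have := rank_lt (inc false j'); have := rank_lt (inc true j').
by unfold_sites; lia.
Qed.

Definition lo_point (c : cell) := spot_point (cell_lo inc port c).
Definition hi_point (c : cell) := spot_point (cell_hi inc port c).

Lemma inner_lo (c : cell) : cell_lo inc port c \in inner_spot.
Proof. by case: c => [[[b q] x]|[j s]] //; apply/inner_road_spot/ltnW. Qed.

Lemma inner_hi (c : cell) : cell_hi inc port c \in inner_spot.
Proof. by case: c => [[[b q] x]|[j s]] //; apply: inner_road_spot. Qed.

Lemma road_cell_points j (s : 'I_L) :
  (lo_point (inr (j, s)) = road_point j s) * (hi_point (inr (j, s)) = road_point j s.+1).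
Proof. by rewrite /lo_point /hi_point /= !road_spot_point // ltnW. Qed.

(** Ports, sites and the corners of roads have even coordinates. *)
Lemma cell_grid_edge c : grid_edge (lo_point c) (hi_point c).
Proof.
case: c => [[[b q] x]|[j s]].
  apply: Or31; rewrite /lo_point /hi_point; unfold_sites => /=.
  by split=> //; case: b; lia.
rewrite !road_cell_points.
have := rank_lt (inc false j); have := rank_lt (inc true j) => ? ?.
have [sz|sz] := ltnP s (site_z true (inc true j) - site_z false (inc false j)).
  apply: Or33; move: sz; unfold_sites => /= ?.
  by split; [congr (_, _, _)|rewrite /port]; lia.
apply: Or32; move: sz; unfold_sites => /= ?.
by split; [congr (_, _, _)|rewrite /port]; lia.
Qed.

Lemma cell_points_inj x y : lo_point x = lo_point y -> hi_point x = hi_point y -> x = y.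
Proof.
(* y + z grows by one along a road cell and is constant on a gadget cell, so the two kinds cannot
   coincide. *)
have sum j s : (road_point j s).1.2 + (road_point j s).2 =
    site_y false (inc false j) + site_z false (inc false j) + s.
  have := rank_lt (inc false j); have := rank_lt (inc true j).
  by unfold_sites => /=; lia.
case: x y => [[[b q] x]|[j s]] [[[b' q'] x']|[j' s']]; rewrite ?road_cell_points.
- move=> /(spot_point_inj (inner_lo (inl (b, q, x))) (inner_lo (inl (b', q', x')))).
  by case=> -> -> xx _; congr (inl (_, _, _)); apply: val_inj.
- rewrite /lo_point /hi_point /= => lo hi; have := sum j' s'; have := sum j' s'.+1.
  by rewrite -lo -hi /=; lia.
- rewrite /lo_point /hi_point /= => lo hi; have := sum j s; have := sum j s.+1.
  by rewrite lo hi /=; lia.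
move=> lo _; have := sum j s; have := sum j' s'; rewrite lo => ->.
case: lo => /port_inj -> _ _ ss; congr (inr (_, _)); apply: val_inj => /=; lia.
Qed.

Definition drawn_graph : rel cell := road_graph inc port.

Lemma drawn_graphE (x y : cell) : drawn_graph x y =
  (x != y) && share (lo_point x) (hi_point x) (lo_point y) (hi_point y).
Proof.
have E p q : p \in inner_spot -> q \in inner_spot ->
  (spot_point p == spot_point q) = (p == q) by move=> *; apply: (inj_in_eq spot_point_inj).
by rewrite /drawn_graph /road_graph /cell_share /share /lo_point /hi_point !E ?inner_lo ?inner_hi.
Qed.

End Drawing.

(** * Flags of the affine plane *)

Section Incidence.

Variable F : finFieldType.

Local Open Scope ring_scope.
Import GRing.Theory.

(* The point (x, y), for [b = false], and the line Y = m X + (y - m x), for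
   [b = true], of the flag (x, y, m). *)
Definition flag_end (b : bool) (f : F * F * F) : F * F :=
  let: (x, y, m) := f in if b then (m, y - m * x) else (x, y).

Lemma flag_simple b i j :
  flag_end b i = flag_end b j -> flag_end (~~ b) i = flag_end (~~ b) j -> i = j.
Proof.
have main i' j' : flag_end false i' = flag_end false j' ->
    flag_end true i' = flag_end true j' -> i' = j'.
  by case: i' j' => [[x y] m] [[x' y'] m'] /= [-> ->] [->].
by case: b => /= h h'; apply: main.
Qed.

Lemma flag_no4 b j1 j2 j3 j4 :
  flag_end b j1 = flag_end b j2 -> flag_end (~~ b) j2 = flag_end (~~ b) j3 ->
  flag_end b j3 = flag_end b j4 -> flag_end (~~ b) j4 = flag_end (~~ b) j1 ->
  j1 = j2 \/ j2 = j3.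
Proof.
have main i1 i2 i3 i4 : flag_end false i1 = flag_end false i2 ->
    flag_end true i2 = flag_end true i3 -> flag_end false i3 = flag_end false i4 ->
    flag_end true i4 = flag_end true i1 -> i1 = i2 \/ i2 = i3.
  case: i1 i2 i3 i4 => [[x1 y1] m1] [[x2 y2] m2] [[x3 y3] m3] [[x4 y4] m4] /=.
  move=> [<- <-] [<- c23] [<- <-] [<- c41].
  have slope (m x y x' y' : F) : y - m * x = y' - m * x' -> m * (x - x') = y - y'.
    move=> h; have -> : y = y' - m * x' + m * x by rewrite -h subrK.
    by rewrite mulrBr addrAC (addrAC y') subrr add0r addrC.
  (* Two points on two common lines: the slopes or the abscissas agree. *)
  have : (m4 - m2) * (x1 - x3) = 0.
    by rewrite mulrBl (slope _ _ _ _ _ c23) (slope _ _ _ _ _ (esym c41)) subrr.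
  move/eqP; rewrite mulf_eq0 !subr_eq0 => /orP[/eqP ->|/eqP xx]; first by left.
  by right; move: c23; rewrite xx => /addIr ->.
case: b => /= h1 h2 h3 h4; last exact: main h1 h2 h3 h4.
(* The cycle is shifted by one to start at a point. *)
have [|j34] := main _ _ _ _ h2 h3 h4 h1; [by right|left].
by apply: (@flag_simple true) => //=; rewrite h2 j34.
Qed.

Lemma flag_connected (A : pred (bool * (F * F))) :
  (forall f, A (false, flag_end false f) = A (true, flag_end true f)) ->
  forall u v, A u = A v.
Proof.
move=> Aflag.
have lines m c m' x : A (true, (m, c)) = A (true, (m', c + (m - m') * x)).
  have := Aflag (x, c + m * x, m); have := Aflag (x, c + m * x, m').
  by rewrite /= addrK => E <-; rewrite E mulrBl addrA.
have lines0 m c : A (true, (m, c)) = A (true, (1, 0)).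
  (* From Y = mX + c to Y = X + c, then Y = 0, then Y = X, meeting at X = 0, -c, 0. *)
  rewrite (lines _ _ 1 0) mulr0 addr0 (lines _ _ 0 (- c)) subr0 mul1r subrr.
  by rewrite (lines _ _ 1 0) mulr0 addr0.
suff A1 u : A u = A (true, (1, 0)) by move=> u v; rewrite !A1.
by case: u => -[] [x y]; rewrite ?lines0 // (Aflag (x, y, 0)) lines0.
Qed.

Definition flag_through (b : bool) (q : F * F) (t : F) : F * F * F :=
  if b then (t, q.2 + q.1 * t, q.1) else (q.1, q.2, t).

Lemma flag_throughK b q t : flag_end b (flag_through b q t) = q.
Proof. by rewrite /flag_through; case: b q => -[u v] /=; rewrite ?addrK. Qed.

Local Close Scope ring_scope.

Lemma flag_degree b q : #|F| <= #|[set f | flag_end b f == q]|.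
Proof.
rewrite -cardsT -(card_imset _ (f := flag_through b q)) => [|t t'].
  by apply/subset_leq_card/subsetP => _ /imsetP[t _ ->]; rewrite inE flag_throughK.
by rewrite /flag_through; case: b => -[].
Qed.

Lemma flag_sites : #|F| <= #|{: F * F}|.
Proof. by rewrite card_prod leq_pmulr // ltnW // card_finNzRing_gt1. Qed.

End Incidence.

(** * Assembly for the eight classes *)

Theorem theorem2 :
  max_cn_infinite line_graph_class /\
  max_cn_infinite two_interval_class /\
  max_cn_infinite two_unit_interval_class /\
  max_cn_infinite axis_segment3_class /\
  max_cn_infinite box3_class /\
  max_cn_infinite unit_cube3_class /\
  max_cn_infinite ball3_class /\
  max_cn_infinite unit_ball3_class.
Proof.
suff main k : exists (T : finType) (e : rel T),
    [/\ simple_graph e, connected_graph e, ~ cops_win e k, line_graph_class e &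
    [/\ axis_segment3_class e, unit_cube3_class e & unit_ball3_class e]].
  repeat apply: conj; move=> k; have [T [e [simp conn rob line [seg cube ball]]]] := main k;
    exists T, e; do 3!apply: conj => //.
  - exact/two_unit_interval_two_interval/line_graph_two_unit_interval.
  - exact: line_graph_two_unit_interval.
  - exact: axis_segment_box.
  - exact: unit_ball_ball.
(* Each vertex has degree at least p, so p >= k + 2 suffices. *)
have [p kp p_prime] := prime_above k.+1.
pose inc := @flag_end 'F_p.
have edgeP := @cell_grid_edge _ _ inc; have injP := @cell_points_inj _ _ inc.
have graphE := @drawn_graphE _ _ inc.
exists _, (drawn_graph inc).
split; [exact: grid_simple graphE| | |exact: grid_line_graph edgeP injP graphE|split].
- apply: road_connected_graph; [exact: port_lt|exact: road_length_long|exact: flag_connected|].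
  by rewrite !card_prod card_Fp // !muln_gt0 prime_gt0.
- apply: road_graph_evasion; [exact: port_lt|exact: road_length_long|exact: flag_simple
   |exact: flag_no4|exact: port_inj| |].
  + by move=> b q; apply: leq_trans kp _; rewrite -[X in X <= _](card_Fp p_prime) flag_degree.
  + by apply: leq_trans (ltnW kp) _; rewrite -[X in X <= _](card_Fp p_prime) flag_sites.
- exact: grid_axis_segment edgeP graphE.
- exact: grid_unit_cube edgeP graphE.
- exact: grid_unit_ball edgeP graphE.
Qed.
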